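(* For all integers $k\ge 10$ and $m\ge 1$ we have $$X_m(k)\ge C_1\cdot\frac{k^{\log_{p+1}(k)/2-6}}{\Gamma(\log_{p+1}(k)+1)},$$ where $$C_1:=\frac12\prod_{j=1}^\infty\left(1-\frac{1}{(p+1)^j+1}\right)$$ and $X_m(k):=\max_{\ell\in\mathbb N}\dim\operatorname{Ext}^k(\Delta_m,\Delta_\ell)$.
   Context: Let $p$ be a prime and $\mathbb F$ an algebraically closed field of characteristic $p$. $\Gamma$ is the Gamma function and $\mathbb N$ is the set of positive integers. For $q\ge 2$ consider a block of polynomial representations of $GL_2(\mathbb F)$ with $p^q$ simple modules (all such blocks are equivalent), and let $\Delta_1,\dots,\Delta_{p^q}$ be its Weyl (= standard) modules, numbered according to the total order on the highest weights in the block. $\operatorname{Ext}^k$ denotes the $k$-th extension group over $\mathbb F$. For positive integers $m,\ell$, $\dim\operatorname{Ext}^k(\Delta_m,\Delta_\ell)$ is computed using any $q\ge2$ with $m,\ell\le p^q$; the value does not depend on $q$. Known description used throughout (Miemietz--Turner): $\operatorname{Ext}^k(\Delta_m,\Delta_\ell)$ has a basis indexed by the finite set $\mathcal B^k(m,\ell)$, so $\dim\operatorname{Ext}^k(\Delta_m,\Delta_\ell)=\sharp\mathcal B^k(m,\ell)$, where $\mathcal B^k(m,\ell)$ is defined as follows. Put $\mathcal P_{\mathfrak c}=\{(s,x,y,t)\in\mathbb Z^4: 1\le s\le t\le p,\ 0\le x+y\le 1,\ t-s=x+2y,\ \text{and } x=y=0\text{ if }s=t\}$; $\mathcal P_0=\{(s,0,0,t)\in\mathbb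 Z^4: 1\le s,t\le p,\ s+t=p+1\}\setminus\{(p,0,0,1)\}$; $\mathcal P_M=\{(s,x,y,t)\in\mathbb Z^4: 1\le s,t\le p,\ x+2y+2=t-1-s+p,\ 0\le x+y+2\le 1\}$; $\mathcal P_{\overline M}=\mathcal P_M\setminus\{(p,0,-1,1)\}$. Let $\mathcal M$ be the set of $(s,x,y,a,b,t)\in\mathbb Z^6$ with $a,b\ge 0$ such that one of the following holds: $a=b$ and $(s,x,y,t)\in\mathcal P_{\mathfrak c}$; or $a=b-1$ and $(s,x,y,t)\in\mathcal P_0$; or $a=b+1$ and $(s,x,y,t)\in\mathcal P_{\overline M}$; or $a>b+1$ and $(s,x,y,t)\in\mathcal P_M$. To such an element associate $i=-a-b$; $j=x-(a-b-1)p+1$ if $a\ge b+1$, $j=x$ if $a=b$, $j=x+1$ if $a=b-1$; and $k=y+(a-b-1)(p-1)$ if $a\ge b+1$, $k=y$ if $a\le b$. Let $\mathcal P_{\Upsilon^{\le 0}}$ be the set of all resulting $(s,i,j,k,a,b,t)\in\mathbb Z^7$, and $\mathcal P_{\Upsilon^{\le 1}}=\mathcal P_{\Upsilon^{\le 0}}\cup\{(s,1,1,0,0,0,p+1-s):1\le s\le p\}$. For $1\le m,\ell\le p^q$ let $s_g,t_g\in\{1,\dots,p\}$ $(1\le g\le q)$ be the unique numbers with $m-1=\sum_{g=1}^q(s_g-1)p^{q-g}$ and $\ell-1=\sum_{g=1}^q(t_g-1)p^{q-g}$. For $k\in\mathbb Z$, $\mathcal B^k(m,\ell)$ is the set of $q$-tuples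 $(\mathbf v_1,\dots,\mathbf v_q)$ with $\mathbf v_g=(s_g,i_g,j_g,k_g,a_g,b_g,t_g)\in\mathcal P_{\Upsilon^{\le 1}}$ for all $g$, $i_1=0$, $i_g=j_{g-1}$ for $2\le g\le q$, and $k_1+\dots+k_q=k$. *)

(* Defs.v *)
From HB Require Import structures.
From Stdlib Require Import Relations.
From mathcomp Require Import all_boot all_order all_algebra.
From mathcomp Require Import finmap.
From mathcomp Require Import all_classical all_reals all_analysis.

Set Implicit Arguments.
Unset Strict Implicit.
Unset Printing Implicit Defensive.

Import Order.TTheory GRing.Theory Num.Theory.
Import numFieldNormedType.Exports.

Local Open Scope classical_set_scope.
Local Open Scope ring_scope.

(* ------------------------------------------------------------------ *)
(* Polynomial representations of GL_2(F) and their Ext groups          *)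
(* ------------------------------------------------------------------ *)

(* A representation acts on column vectors.  Only the values of [ract] on
   invertible matrices matter; every condition below is restricted to them. *)
Record rep (F : fieldType) :=
  Rep { rdim : nat; ract :> 'M[F]_2 -> 'M[F]_rdim }.

Definition is_polynomial_function (F : fieldType) (f : 'M[F]_2 -> F) : Prop :=
  exists (d : nat) (c : {ffun 'I_2 * 'I_2 -> 'I_d} -> F),
    forall g, g \in unitmx ->
      f g = \sum_(e : {ffun 'I_2 * 'I_2 -> 'I_d})
              c e * \prod_(ij : 'I_2 * 'I_2) g ij.1 ij.2 ^+ e ij.

Definition polynomial_rep (F : fieldType) (M : rep F) : Prop :=
  [/\ M 1%:M = 1%:M,
      forall g h, g \in unitmx -> h \in unitmx -> M (g *m h) = M g *m M h
    & forall i j, is_polynomial_function (fun g => M g i j)].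

Definition hom (F : fieldType) (M N : rep F) : set 'M[F]_(rdim N, rdim M) :=
  [set X | forall g, g \in unitmx -> X *m M g = N g *m X].
Arguments hom {F} M N.

Definition projective (F : fieldType) (P : rep F) : Prop :=
  polynomial_rep P /\
  forall (M N : rep F) (h : 'M[F]_(rdim N, rdim M)) (f : 'M[F]_(rdim N, rdim P)),
    polynomial_rep M -> polynomial_rep N ->
    hom M N h -> \rank h = rdim N -> hom P N f ->
    exists2 f' : 'M[F]_(rdim M, rdim P), hom P M f' & h *m f' = f.

Definition exact_pair (F : fieldType) (l m n : nat)
    (A : 'M[F]_(l, m)) (B : 'M[F]_(m, n)) : Prop :=
  A *m B = 0 /\ (\rank A + \rank B)%N = m.

Definition projective_resolution (F : fieldType) (M : rep F) (P : nat -> rep F)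
    (d : forall i, 'M[F]_(rdim (P i), rdim (P i.+1)))
    (aug : 'M[F]_(rdim M, rdim (P 0%N))) : Prop :=
  [/\ forall i, projective (P i),
      hom (P 0%N) M aug /\ forall i, hom (P i.+1) (P i) (d i),
      \rank aug = rdim M,
      exact_pair aug (d 0%N)
    & forall i, exact_pair (d i) (d i.+1)].

Definition cocycles (F : fieldType) (N : rep F) (P : nat -> rep F)
    (d : forall i, 'M[F]_(rdim (P i), rdim (P i.+1))) (k : nat) :
    set 'M[F]_(rdim N, rdim (P k)) :=
  [set f | hom (P k) N f /\ f *m d k = 0].
Arguments cocycles {F} N {P} d k.

Definition coboundaries (F : fieldType) (N : rep F) (P : nat -> rep F)
    (d : forall i, 'M[F]_(rdim (P i), rdim (P i.+1))) (k : nat) :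
    set 'M[F]_(rdim N, rdim (P k)) :=
  match k with
  | 0 => [set 0]
  | k'.+1 => [set f *m d k' | f in hom (P k') N]
  end.
Arguments coboundaries {F} N {P} d k.

Definition quotient_dim (F : fieldType) (V : lmodType F) (Z B : set V)
    (n : nat) : Prop :=
  exists e : 'I_n -> V, (forall i, Z (e i)) /\
    forall z, Z z -> exists! c : 'rV[F]_n, B (z - \sum_i c 0 i *: e i).

(* dim Ext^k(M, N) in the category of finite-dimensional polynomial
   representations, which has enough projectives; the set has exactly one
   element since cohomology does not depend on the resolution. *)
Definition dim_ext (F : fieldType) (k : nat) (M N : rep F) : nat :=
  xget 0%N [set n | exists (P : nat -> rep F)
      (d : forall i, 'M[F]_(rdim (P i), rdim (P i.+1)))
      (aug : 'M[F]_(rdim M, rdim (P 0%N))),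
    projective_resolution d aug /\
    quotient_dim (cocycles N d k) (coboundaries N d k) n].

(* ------------------------------------------------------------------ *)
(* Weyl modules and blocks                                             *)
(* ------------------------------------------------------------------ *)

(* Polynomial dominant weights of GL_2 are the pairs l1 >= l2 >= 0. *)
Definition dominant (lam : nat * nat) : bool := (lam.2 <= lam.1)%N.

(* D^a(E) (x) det^b, where a = l1 - l2, b = l2, E = F^2 and D^a is the divided
   power, in the basis e_0^(a-i) e_1^(i); equivalently, the contravariant
   (transpose) dual of Sym^a(E) (x) det^b. *)
Definition weyl (F : fieldType) (lam : nat * nat) : rep F :=
  let a := (lam.1 - lam.2)%N in
  Rep (fun g : 'M[F]_2 => \matrix_(i < a.+1, j < a.+1)
    (\det g ^+ lam.2 *
     (((g 0 0)%:P + (g 0 1) *: 'X) ^+ (a - i) *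
      ((g 1 0)%:P + (g 1 1) *: 'X) ^+ i)`_j)).

(* L is the simple head of the Weyl module of highest weight lam. *)
Definition simple_head (F : fieldType) (lam : nat * nat) (L : rep F) : Prop :=
  [/\ polynomial_rep L, (0 < rdim L)%N,
      forall (N : rep F) (X : 'M[F]_(rdim L, rdim N)),
        polynomial_rep N -> hom N L X -> X = 0 \/ \rank X = rdim L
    & exists2 X : 'M[F]_(rdim L, rdim (weyl F lam)),
        hom (weyl F lam) L X & \rank X = rdim L].

Definition ext1_linked (F : fieldType) (lam mu : nat * nat) : Prop :=
  [/\ dominant lam, dominant mu
    & exists L L' : rep F, [/\ simple_head lam L, simple_head mu L'
                             & dim_ext 1 L L' <> 0%N]].

(* ws lists in increasing order the highest weights of the simple modules of
   one block.  All of them have the same degree l1 + l2, so comparing the l1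
   is the (total) dominance order. *)
Definition block_weights (F : fieldType) (ws : seq (nat * nat)) : Prop :=
  [/\ ws <> [::], all dominant ws,
      sorted (fun lam mu : nat * nat => (lam.1 < mu.1)%N) ws
    & forall lam mu, lam \in ws -> dominant mu ->
        (mu \in ws <-> clos_refl_sym_trans _ (@ext1_linked F) lam mu)].

(* Delta_m, numbered from m = 1. *)
Definition Delta (F : fieldType) (ws : seq (nat * nat)) (m : nat) : rep F :=
  weyl F (nth (0, 0)%N ws m.-1).

(* blk q is a block with p^q simple modules, for each q >= 2. *)
Definition ext_dims (F : fieldType) (p : nat) (blk : nat -> seq (nat * nat))
    (m k : nat) : set nat :=
  [set n | exists q l : nat,
    [/\ (2 <= q)%N, (1 <= m <= p ^ q)%N, (1 <= l <= p ^ q)%N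
      & n = dim_ext k (Delta F (blk q) m) (Delta F (blk q) l)]].

(* X = max_l dim Ext^k(Delta_m, Delta_l) *)
Definition is_max_ext_dim (F : fieldType) (p : nat) (blk : nat -> seq (nat * nat))
    (m k X : nat) : Prop :=
  ext_dims F p blk m k X /\ forall n, ext_dims F p blk m k n -> (n <= X)%N.

(* ------------------------------------------------------------------ *)
(* The sets B^k(m, l)                                                  *)
(* ------------------------------------------------------------------ *)

Definition Pc (p : nat) (s x y t : int) : Prop :=
  [/\ 1 <= s, s <= t, t <= p%:Z & 0 <= x + y <= 1] /\
  t - s = x + 2 * y /\ (s = t -> x = 0 /\ y = 0).

Definition P0 (p : nat) (s x y t : int) : Prop :=
  [/\ 1 <= s <= p%:Z, 1 <= t <= p%:Z, s + t = p%:Z + 1, x = 0 & y = 0] /\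
  (s, x, y, t) <> (p%:Z, 0, 0, 1).

Definition PM (p : nat) (s x y t : int) : Prop :=
  [/\ 1 <= s <= p%:Z, 1 <= t <= p%:Z,
      x + 2 * y + 2 = t - 1 - s + p%:Z & 0 <= x + y + 2 <= 1].

Definition PMbar (p : nat) (s x y t : int) : Prop :=
  PM p s x y t /\ (s, x, y, t) <> (p%:Z, 0, -1, 1).

Definition calM (p : nat) (s x y a b t : int) : Prop :=
  [/\ 0 <= a, 0 <= b
    & [\/ a = b /\ Pc p s x y t,
          a = b - 1 /\ P0 p s x y t,
          a = b + 1 /\ PMbar p s x y t
        | b + 1 < a /\ PM p s x y t]].

Definition idx_j (p : nat) (x a b : int) : int :=
  if b + 1 <= a then x - (a - b - 1) * p%:Z + 1
  else if a == b then x
  else x + 1.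

Definition idx_k (p : nat) (y a b : int) : int :=
  if b + 1 <= a then y + (a - b - 1) * (p%:Z - 1) else y.

(* (s, i, j, k, a, b, t) *)
Definition vec7 : Type := (int * int * int * int * int * int * int)%type.

Definition v_s (v : vec7) : int := let: (s, i, j, k, a, b, t) := v in s.
Definition v_i (v : vec7) : int := let: (s, i, j, k, a, b, t) := v in i.
Definition v_j (v : vec7) : int := let: (s, i, j, k, a, b, t) := v in j.
Definition v_k (v : vec7) : int := let: (s, i, j, k, a, b, t) := v in k.
Definition v_t (v : vec7) : int := let: (s, i, j, k, a, b, t) := v in t.

Definition Upsilon0 (p : nat) : set vec7 :=
  [set v : vec7 | exists s x y a b t : int, calM p s x y a b t /\
     v = (s, - a - b, idx_j p x a b, idx_k p y a b, a, b, t)].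

Definition Upsilon1 (p : nat) : set vec7 :=
  Upsilon0 p `|`
  [set v : vec7 | exists s : int, 1 <= s <= p%:Z /\
     v = (s, 1, 1, 0, 0, 0, p%:Z + 1 - s)].

(* The index g = 1..q of the tuple is shifted to 'I_q = {0..q-1}.  The entries
   v_s, v_t of elements of Upsilon1 lie in 1..p, so the two digit-sum equations
   say that they are the base-p digits (plus one) of m - 1 and l - 1. *)
Definition calB (p q : nat) (k : int) (m l : nat) : set {ffun 'I_q -> vec7} :=
  [set v | [/\ forall g, Upsilon1 p (v g),
      m%:Z - 1 = \sum_(g < q) (v_s (v g) - 1) * (p ^ (q - g.+1))%N%:Z,
      l%:Z - 1 = \sum_(g < q) (v_t (v g) - 1) * (p ^ (q - g.+1))%N%:Z
    & [/\ forall g : 'I_q, g = 0%N :> nat -> v_i (v g) = 0,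
      forall g h : 'I_q, h = g.+1 :> nat -> v_i (v h) = v_j (v g)
    & \sum_(g < q) v_k (v g) = k]]].
Arguments calB p q k m l : clear implicits.

(* ------------------------------------------------------------------ *)
(* The analytic side                                                   *)
(* ------------------------------------------------------------------ *)

(* Euler's integral, for z > 0. *)
Definition Gamma (R : realType) (z : R) : R :=
  \int[lebesgue_measure]_(u in `]0, +oo[) (u `^ (z - 1) * expR (- u)).

Definition logb (R : realType) (b x : R) : R := ln x / ln b.

Definition C1 (R : realType) (p : nat) : R :=
  2^-1 * lim ((fun n : nat =>
    \prod_(1 <= j < n.+1) (1 - ((p.+1)%:R ^+ j + 1)^-1 : R)) @ \oo).

(* Main.v *)
(** Read an element of B^k(m, l) as a walk through the states i_1, i_2, ...,
    starting at 0.  Every letter costs k_g >= 0, and from a state -n <= 0 the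
    next state -n' satisfies n' <= n + k_g.

    The maximum exists because, for prescribed digits, the walk has no choice
    in state 1, nor in state 0 when s_g = t_g; in state 0 with s_g <> t_g it
    goes to state 1 or pays k_g >= 1; and from a negative state it pays, or goes
    to 0 or 1, or reads the digit s_g = p.  Since m has at most m - 1 digits
    s_g >= 2, only boundedly many letters involve a choice, uniformly in q, l.

    For the lower bound, letters with s_g = 1 allow n' = p (n - 2 b) + t_g - 1
    for any b with n - 2 b >= 1, at cost n' - n + 2 b.  If b_r is the value of b
    used r letters before the walk leaves the negative states, then
    k = nu - 2 sum_r b_r (p^r - 1), where nu has the base p digits t_g - 1.
    There are (B+1)^R choices of b_1, ..., b_R <= B, all admissible when
    2 R B + p^R <= k, but fewer than (B+1) p^(R+1) values of nu; so some nu,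
    and hence some l, is hit often.  With p^(R+1) <= k and B about k / (4 R)
    the count is at least about k^((R-3)/2), which beats the claim even with
    Gamma bounded below by a constant. *)

Require Import Defs.
From mathcomp Require Import all_boot all_order all_algebra.
From mathcomp Require Import finmap.
From mathcomp Require Import all_classical all_reals all_analysis.
From mathcomp Require Import measurable_realfun.
From mathcomp Require Import zify ring lra.
Import Order.TTheory GRing.Theory Num.Theory.
Import numFieldNormedType.Exports.
Local Open Scope ring_scope.


(** * Letters: the elements of [Upsilon1], state by state *)

Definition v_a (v : vec7) : int := let: (s, i, j, k, a, b, t) := v in a.
Definition v_b (v : vec7) : int := let: (s, i, j, k, a, b, t) := v in b.

(** For a >= b + 1 the last bound amounts to -2 - x - y <= 2b, which follows from x + y >= -2. The
    bounds on a and b later confine the letters to a finite box. *)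
Lemma Upsilon1_step (p : nat) (v : vec7) : (2 <= p)%N -> Upsilon1 p v ->
  [/\ 1 <= v_s v <= p%:Z, 1 <= v_t v <= p%:Z, 0 <= v_k v, v_i v <= 1 &
      v_j v <= 1] /\
  (v_i v <= 0 ->
    [/\ 0 <= v_a v <= - v_i v, 0 <= v_b v <= - v_i v & - v_j v <= - v_i v + v_k v]).
Proof.
move=> p2 [[s [x [y [a [b [t [[a0 b0 h] ->]]]]]]]|[s [hs ->]]]; last by rewrite /=; split; [split|]; lia.
rewrite /= /idx_j /idx_k.
case: h => [[e [[h1 h2 h3 h4] [h5 h6]]]|[e [[h1 h2 h3 -> ->] h5]]|[e [[h1 h2 h3 h4] h5]]|[h0 [h1 h2 h3 h4]]]; try subst a.
- rewrite eqxx; case: ifP => ?; first lia.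
  have ? : s = t \/ s <> t by case: (eqVneq s t) => [|/eqP]; [left|right].
  by split; [split|move=> _; split]; lia.
- case: ifP => ?; first lia.
  case: eqP => ?; first lia.
  by split; [split|move=> _; split]; lia.
- rewrite lexx.
  (* On [PM], y >= -1, and y = -1 only at (p, 0, -1, 1), the quadruple removed from [PMbar]; hence k
     >= 0. For a > b + 1 the term (a - b - 1)(p - 1) >= 1 compensates. *)
  have ? : ~ (s = p%:Z /\ y = - 1).
    by move=> [e1 e2]; apply: h5; congr (_, _, _, _); lia.
  by split; [split|move=> _; split]; lia.
- case: ifP => ?; last lia.
  by split; [split|move=> _; split]; nia.
Qed.

Lemma Upsilon1_state1 (p : nat) (v : vec7) : (2 <= p)%N -> Upsilon1 p v ->
  v_i v = 1 -> v = (v_s v, 1, 1, 0, 0, 0, v_t v).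
Proof.
move=> p2 [[s [x [y [a [b [t [[a0 b0 h] ->]]]]]]]|[s [hs ->]]] //=; lia.
Qed.

(** Here a = b = 0, so the quadruple is in [Pc]; for s < t, t - s = (x + y) + y with x + y <= 1
    leaves y >= 1 or (x, y) = (1, 0). *)
Lemma Upsilon1_state0 (p : nat) (v : vec7) : (2 <= p)%N -> Upsilon1 p v ->
  v_i v = 0 -> if v_s v == v_t v then v = (v_s v, 0, 0, 0, 0, 0, v_t v)
               else v_j v = 1 \/ 1 <= v_k v.
Proof.
move=> p2 [[s [x [y [a [b [t [[a0 b0 h] ->]]]]]]]|[s [hs ->]]] //= i0.
have [ea eb] : a = 0 /\ b = 0 by split; lia.
subst a b; rewrite /idx_j /idx_k /=.
case: h => [[_ [[h1 h2 h3 h4] [h5 h6]]]|[h _]|[h _]|[h _]] //.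
case: eqP => [e|ne]; last lia.
by case: (h6 e) => -> ->; rewrite oppr0.
Qed.

(** The last alternative comes from [PM]: there k = 0 and j < 0 force s = p and t = 1. *)
Lemma Upsilon1_state_neg (p : nat) (v : vec7) : (2 <= p)%N -> Upsilon1 p v ->
  v_i v < 0 -> [\/ 1 <= v_k v, v_j v = 0, v_j v = 1 | v_s v = p%:Z].
Proof.
move=> p2 [[s [x [y [a [b [t [[a0 b0 h] ->]]]]]]]|[s [hs ->]]] //= i0.
rewrite /idx_j /idx_k.
suff : ~ [/\ ~ 1 <= (if b + 1 <= a then y + (a - b - 1) * (p%:Z - 1) else y),
     ~ (if b + 1 <= a then x - (a - b - 1) * p + 1 else if a == b then x else x + 1) = 0,
     ~ (if b + 1 <= a then x - (a - b - 1) * p + 1 else if a == b then x else x + 1) = 1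
     & ~ s = p%:Z].
  move=> h'; apply: contrapT => h1; apply: h'; split => h2; apply: h1.
  by constructor 1. by constructor 2. by constructor 3. by constructor 4.
case: h => [[e [[h1 h2 h3 h4] [h5 h6]]]|[e [[h1 h2 h3 -> ->] h5]]|[e [[h1 h2 h3 h4] h5]]|[h0 [h1 h2 h3 h4]]]; try subst a.
- rewrite eqxx; case: ifP => ? []; lia.
- case: ifP => ?; first lia.
  by case: eqP => ? []; lia.
- by rewrite lexx => -[]; lia.
- by case: ifP => ? []; last lia; nia.
Qed.

(** * Finiteness: bounded choice for walks with prescribed digits *)

Definition atmost (T : eqType) (N : nat) (A : set T) : Prop :=
  exists2 s : seq T, (size s <= N)%N & forall x, A x -> x \in s.

Lemma atmost_cons (T : eqType) (c N : nat) (A : set (seq T)) (C : set T) :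
  atmost T c C -> (forall v, C v -> atmost (seq T) N (fun w => A (v :: w))) ->
  (forall w, A w -> exists v w', w = v :: w' /\ C v) ->
  atmost (seq T) (c * N) A.
Proof.
move=> [S Sc CS] AN AC.
have /choice[f fP] : forall v, exists s : seq (seq T),
    (size s <= N)%N /\ (C v -> forall w, A (v :: w) -> w \in s).
  move=> v; have [Cv|nCv] := pselect (C v); last by exists [::].
  by have [s sN As] := AN v Cv; exists s.
exists [seq v :: w | v <- S, w <- f v].
  rewrite size_allpairs_dep; apply: (@leq_trans (size S * N)%N); last by rewrite leq_mul2r Sc orbT.
  elim: S {Sc CS} => //= v S IH; rewrite mulSn leq_add //.
  by case: (fP v).
move=> w Aw; have [v [w' [e Cv]]] := AC w Aw; subst w.
apply/allpairsPdep; exists v, w'; split => //; first exact: CS.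
by case: (fP v) => _ /(_ Cv); apply.
Qed.

(** Lists instead of finite functions allow induction on the first letter; [i] is the current state
    and [K] the cost still to be paid. *)
Fixpoint chain (p : nat) (st : seq (int * int)) (i K : int) (w : seq vec7) : Prop :=
  match st, w with
  | [::], [::] => K = 0
  | d :: st', v :: w' =>
      [/\ Upsilon1 p v, v_s v = d.1, v_t v = d.2, v_i v = i
        & chain p st' (v_j v) (K - v_k v) w']
  | _, _ => False
  end.

Lemma chain_ge0 (p : nat) (st : seq (int * int)) (i K : int) (w : seq vec7) :
  (2 <= p)%N -> chain p st i K w -> 0 <= K.
Proof.
move=> p2; elim: st i K w => [|d st IH] i K [|v w] //=; first by move=> ->.
by move=> [Uv _ _ _ /IH]; have [[_ _ ? _ _] _] := Upsilon1_step p v p2 Uv; lia.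
Qed.

(** Since j <= 1, the natural number 1 - j encodes j; it reaches H + 1, whence [H.+2] values. *)
Definition box (H : nat) (s i t : int) : seq vec7 :=
  let I := iota 0 H.+2 in
  let P := [seq (x, y) | x <- I, y <- I] in
  [seq (s, i, 1 - z.1.1%:Z, z.1.2%:Z, z.2.1%:Z, z.2.2%:Z, t) |
     z <- [seq (x, y) | x <- P, y <- P]].

Lemma size_box (H : nat) (s i t : int) : size (box H s i t) = (H.+2 ^ 4)%N.
Proof. by rewrite size_map !size_allpairs size_iota !mulnn -expnM. Qed.

Lemma mem_box (H : nat) (v : vec7) :
  v_j v <= 1 -> - v_j v <= H%:Z -> 0 <= v_k v <= H%:Z -> 0 <= v_a v <= H%:Z ->
  0 <= v_b v <= H%:Z -> v \in box H (v_s v) (v_i v) (v_t v).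
Proof.
case: v => [[[[[[s i] j] k] a] b] t] /= j1 jH kH aH bH.
apply/mapP; exists ((`|1 - j|%N, `|k|%N), (`|a|%N, `|b|%N)).
  by apply/allpairsP; exists ((`|1 - j|%N, `|k|%N), (`|a|%N, `|b|%N)); split => //;
    apply/allpairsP; [exists (`|1 - j|%N, `|k|%N)|exists (`|a|%N, `|b|%N)];
    split => //; rewrite mem_iota /fst /snd; lia.
by rewrite /=; congr (_, _, _, _, _, _, _); lia.
Qed.

(* A letter with a choice either lowers K + u, where u counts the remaining
   digits s >= 2, or moves up in the order: negative state, 0, 1. *)
Lemma chain_atmost (p H : nat) (st : seq (int * int)) (i : int) (K : nat) :
  (2 <= p)%N -> i <= 1 -> K%:Z - i <= H%:Z ->
  atmost (seq vec7)
    ((H.+2 ^ 4) ^ (2 * (K + count (fun d : int * int => (2 <= d.1)%R) st) +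
                   (if i == 1 then 0 else if i == 0 then 1 else 2)))%N
    (chain p st i K%:Z).
Proof.
move=> p2; set A := (H.+2 ^ 4)%N.
have A0 : (0 < A)%N by rewrite expn_gt0.
elim: st i K => [|[s t] st IH] i K i1 iH.
  exists [:: [::]]; first by rewrite expn_gt0 A0.
  by case=> // v w.
rewrite [count _ _]/=; set u := count _ st.
set A1 := chain p ((s, t) :: st) i K%:Z.
(* The quantity K - i never grows along the walk, so a single [H] bounds every box. *)
have step (v : vec7) (w : seq vec7) : A1 (v :: w) ->
  [/\ v_j v <= 1, v_k v <= K%:Z, 0 <= v_k v & K%:Z - v_k v - v_j v <= H%:Z].
  move=> [Uv _ _ vi /(chain_ge0 _ _ _ _ _ p2) ?].
  have [[_ _ ? ? ?] h] := Upsilon1_step p v p2 Uv.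
  have [/h[_ _ ?]|v1] : v_i v <= 0 \/ v_i v = 1 by lia.
    by split; lia.
  have ej : v_j v = 1 by rewrite (Upsilon1_state1 p v p2 Uv v1).
  by split; lia.
have next (v : vec7) (e : nat) :
    (forall w, A1 (v :: w) -> 2 * (`|(K%:Z - v_k v)%R| + u) +
       (if v_j v == 1 then 0 else if v_j v == 0 then 1 else 2) <= e)%N ->
    atmost (seq vec7) (A ^ e) (fun w => A1 (v :: w)).
  move=> he; have [[w Aw]|nA] := pselect (exists w, A1 (v :: w)); last first.
    by exists [::] => // w Aw; case: nA; exists w.
  have [h1 h2 h3 h4] := step v w Aw.
  have eK : K%:Z - v_k v = `|(K%:Z - v_k v)%R|%N%:Z by lia.
  have := IH (v_j v) `|(K%:Z - v_k v)%R|%N h1; rewrite -eK => /(_ h4).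
  case=> S sS hS; exists S; last by move=> w' [_ _ _ _ /hS].
  by rewrite (leq_trans sS)// leq_pexp2l// (he w).
have A1P w : A1 w -> exists v w', w = v :: w' /\ A1 (v :: w').
  by case: w => // v w h; exists v, w.
(* A forced letter costs no factor [A], so the bound does not see the length of [st]. *)
have single (v0 : vec7) (e : nat) :
    (forall v w, A1 (v :: w) -> v = v0) ->
    (forall w, A1 (v0 :: w) -> 2 * (`|(K%:Z - v_k v0)%R| + u) +
       (if v_j v0 == 1 then 0 else if v_j v0 == 0 then 1 else 2) <= e)%N ->
    atmost (seq vec7) (A ^ e) A1.
  move=> h he; rewrite -[(A ^ e)%N]mul1n.
  apply: (atmost_cons _ _ _ _ (fun v => v = v0)) => [|v ->|w /A1P[v [w' [-> /h ->]]]].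
  - by exists [:: v0] => // v ->; rewrite inE.
  - exact: next.
  - by exists v0, w'.
(* A choice costs one factor [A]. The weight 2 on K + u lets a drop by 1 pay for it even when the
   walk goes back from state 0 (weight 1) to a negative state (weight 2). *)
have many (e : nat) : (i <= 0) ->
    (forall v w, A1 (v :: w) -> 2 * (`|(K%:Z - v_k v)%R| + u) +
       (if v_j v == 1 then 0 else if v_j v == 0 then 1 else 2) <= e)%N ->
    atmost (seq vec7) (A ^ e.+1) A1.
  move=> i0 he; rewrite expnS.
  apply: (atmost_cons _ _ _ _ (fun v => exists w, A1 (v :: w))) => [|v _|w].
  - exists (box H s i t); first by rewrite size_box.
    move=> v [w Aw]; have [h1 h2 h3 h4] := step v w Aw.
    move: Aw => [Uv /= <- <- vi _]; rewrite -vi.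
    have [_ h] := Upsilon1_step p v p2 Uv.
    have [h5 h6 h7] : [/\ 0 <= v_a v <= - v_i v, 0 <= v_b v <= - v_i v
      & - v_j v <= - v_i v + v_k v] by apply: h; rewrite vi.
    by apply: mem_box; lia.
  - by apply: next => w; apply: (he v w).
  - by move=> /A1P[v [w' [-> h]]]; exists v, w'; split=> //; exists w'.
have [i_eq1|i_neq1] := eqVneq i 1.
  apply: (single (s, 1, 1, 0, 0, 0, t)) => [v w [Uv /= <- <- vi _]|w _] /=; last lia.
  by apply: (Upsilon1_state1 p v p2 Uv); rewrite vi.
have [i_eq0|i_neq0] := eqVneq i 0.
  have [st_eq|st_neq] := eqVneq s t.
    apply: (single (s, 0, 0, 0, 0, 0, t)) => [v w [Uv /= vs vt vi _]|w _] /=; last lia.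
    have := Upsilon1_state0 p v p2 Uv; rewrite vi vs vt st_eq eqxx; exact.
  rewrite addn1; apply: many; first by rewrite i_eq0.
  move=> v w Aw; have [h1 h2 h3 h4] := step v w Aw.
  move: Aw => [Uv /= vs vt vi _].
  have := Upsilon1_state0 p v p2 Uv; rewrite vi vs vt (negbTE st_neq) => /(_ i_eq0).
  case=> [->|?]; first by rewrite eqxx; lia.
  by case: ifP => _; [|case: ifP => _]; lia.
rewrite addn2; apply: many; first lia.
move=> v w Aw; have [h1 h2 h3 h4] := step v w Aw.
move: Aw => [Uv /= vs vt vi _].
have i_lt0 : v_i v < 0 by lia.
case: (Upsilon1_state_neg p v p2 Uv i_lt0) => [?|->|->|].
- by case: ifP => _; [|case: ifP => _]; lia.
- by rewrite /=; lia.
- by rewrite /=; lia.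
(* Here s = p >= 2, so this digit was counted and u drops. *)
- rewrite vs => ->; case: ifP => _; [|case: ifP => _]; lia.
Qed.

(** * Base p digits, and tuples of [calB] as chains *)

Lemma digits_uniq (p q M : nat) (d : nat -> nat) :
  (forall g, g < q -> d g < p)%N ->
  M = (\sum_(g < q) d g * p ^ (q - g.+1))%N ->
  forall g, (g < q)%N -> d g = (M %/ p ^ (q - g.+1) %% p)%N.
Proof.
elim: q M => // q IH M dp; rewrite big_ord_recr /= subnn expn0 muln1.
have -> : (\sum_(g < q) d g * p ^ (q.+1 - g.+1) =
           (\sum_(g < q) d g * p ^ (q - g.+1)) * p)%N.
  rewrite big_distrl; apply: eq_bigr => g _ /=.
  by rewrite -mulnA -expnSr; congr (_ * p ^ _)%N; have := ltn_ord g; lia.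
set N := bigop _ _ _ => -> g gq.
have p0 : (0 < p)%N by have := dp q (ltnSn q); lia.
have [->|gneq] := eqVneq g q.
  by rewrite subnn expn0 divn1 modnMDl modn_small ?dp.
have gq' : (g < q)%N by lia.
rewrite (IH N)// => [|h hq]; last by apply: dp; lia.
rewrite [in RHS](_ : q.+1 - g.+1 = (q - g.+1).+1)%N; last lia.
rewrite expnS divnMA divnMDl // (divn_small (dp q _)) ?addn0 //.
Qed.

Lemma chain_nth (p : nat) (v0 : vec7) (d0 : int * int) (st : seq (int * int))
    (i K : int) (w : seq vec7) :
  size w = size st ->
  (forall g, (g < size w)%N -> [/\ Upsilon1 p (nth v0 w g),
     v_s (nth v0 w g) = (nth d0 st g).1 & v_t (nth v0 w g) = (nth d0 st g).2]) ->
  ((0 < size w)%N -> v_i (nth v0 w 0) = i) ->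
  (forall g, (g.+1 < size w)%N -> v_i (nth v0 w g.+1) = v_j (nth v0 w g)) ->
  K = \sum_(v <- w) v_k v -> chain p st i K w.
Proof.
elim: w st i K => [|v w IH] [|d st] i K //=; first by rewrite big_nil.
move=> [sz] Uv vi vj; rewrite big_cons => ->.
have [/= ? ? ?] := Uv 0%N isT; split => //; first exact: vi.
apply: IH => // [g gw|w0|g gw|].
- exact: (Uv g.+1).
- exact: (vj 0%N).
- exact: (vj g.+1).
- by rewrite addrC addKr.
Qed.

Lemma calB_digits (p q : nat) (k : int) (m l : nat) (v : {ffun 'I_q -> vec7}) :
  (2 <= p)%N -> (1 <= m)%N -> (1 <= l)%N -> calB p q k m l v ->
  (m.-1 = \sum_(g < q) `|(v_s (v g) - 1)%R| * p ^ (q - g.+1))%N /\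
  forall g : 'I_q, v_s (v g) = (m.-1 %/ p ^ (q - g.+1) %% p)%N%:Z + 1 /\
                   v_t (v g) = (l.-1 %/ p ^ (q - g.+1) %% p)%N%:Z + 1.
Proof.
move=> p2 m1 l1 [Uv ms ls _].
have rng g : (1 <= v_s (v g) <= p%:Z) /\ (1 <= v_t (v g) <= p%:Z).
  by have [[? ? _ _ _] _] := Upsilon1_step p _ p2 (Uv g).
have aux (n : nat) (f : vec7 -> int) : (1 <= n)%N ->
    (forall g, 1 <= f (v g) <= p%:Z) ->
    n%:Z - 1 = \sum_(g < q) (f (v g) - 1) * (p ^ (q - g.+1))%N%:Z ->
    (n.-1 = \sum_(g < q) `|(f (v g) - 1)%R| * p ^ (q - g.+1))%N /\
    forall g : 'I_q, f (v g) = (n.-1 %/ p ^ (q - g.+1) %% p)%N%:Z + 1.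
  move=> n1 fr e.
  have e' : (n.-1 = \sum_(g < q) `|(f (v g) - 1)%R| * p ^ (q - g.+1))%N.
    apply/eqP; rewrite -eqz_nat (big_morph _ PoszD (erefl 0%:Z)); apply/eqP.
    transitivity (n%:Z - 1); first lia.
    by rewrite e; apply: eq_bigr => g _; rewrite PoszM; congr (_ * _); have := fr g; lia.
  split=> // g.
  pose d h := if insub h is Some h' then `|(f (v h') - 1)%R|%N else 0%N.
  have dE (h : 'I_q) : d h = `|(f (v h) - 1)%R|%N by rewrite /d valK.
  have dp h : (h < q)%N -> (d h < p)%N.
    by move=> hq; rewrite (dE (Ordinal hq)); have := fr (Ordinal hq); lia.
  have := digits_uniq p q n.-1 d dp.
  under eq_bigr do rewrite dE.
  by move=> /(_ e' g (ltn_ord g)); rewrite dE => <-; have := fr g; lia.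
have [e1 h1] := aux m v_s m1 (fun g => (rng g).1) ms.
have [e2 h2] := aux l v_t l1 (fun g => (rng g).2) ls.
by split.
Qed.

Lemma nth_map_enum_ord (T : Type) (x0 : T) (q : nat) (f : 'I_q -> T) (g : nat)
    (gq : (g < q)%N) : nth x0 [seq f h | h <- enum 'I_q] g = f (Ordinal gq).
Proof.
rewrite (nth_map (Ordinal gq)) ?size_enum_ord //.
by congr f; apply: val_inj; rewrite /= nth_enum_ord.
Qed.

(** The bound involves neither q nor l, so it serves for all l at once. *)
Lemma calB_atmost (p q k m l : nat) : (2 <= p)%N -> (1 <= m)%N -> (1 <= l)%N ->
  atmost {ffun 'I_q -> vec7} ((k.+2 ^ 4) ^ (2 * (k + m)).+1)%N (calB p q k%:Z m l).
Proof.
move=> p2 m1 l1.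
have [[v0 Bv0]|nB] := pselect (exists v, calB p q k%:Z m l v); last first.
  by exists [::] => // v Bv; case: nB; exists v.
(* The digits are determined by m and l, hence shared by all elements; they can be read off [v0]. *)
pose st := [seq (v_s (v0 g), v_t (v0 g)) | g <- enum 'I_q].
have k_le : k%:Z - 0 <= k%:Z by rewrite subr0.
have [S sS hS] := chain_atmost p k st 0 k p2 isT k_le.
pose x0 : vec7 := (0, 0, 0, 0, 0, 0, 0).
exists [seq [ffun g : 'I_q => nth x0 w g] | w <- S].
  rewrite size_map (leq_trans sS)// leq_pexp2l ?expn_gt0 //.
  rewrite /= addn1 ltnS leq_mul2l /= leq_add2l.
  (* Each s_g >= 2 contributes at least 1 to m - 1. *)
  apply: (@leq_trans m.-1); last exact: leq_pred.
  have [-> _] := calB_digits p q k%:Z m l v0 p2 m1 l1 Bv0.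
  rewrite count_map -sum1_count big_mkcond /= big_enum /=.
  apply: leq_sum => g _; case: ifP => //= h.
  by rewrite muln_gt0 expn_gt0 (ltnW p2) andbT; lia.
move=> v Bv; apply/mapP; exists [seq v g | g <- enum 'I_q].
  apply: hS; apply: (chain_nth p x0 (0, 0)).
  - by rewrite !size_map.
  - move=> g; rewrite size_map size_enum_ord => gq.
    rewrite !(nth_map_enum_ord _ _ _ _ _ gq) /=.
    have [_ /(_ (Ordinal gq))[-> ->]] := calB_digits p q k%:Z m l v p2 m1 l1 Bv.
    have [_ /(_ (Ordinal gq))[-> ->]] := calB_digits p q k%:Z m l v0 p2 m1 l1 Bv0.
    by split=> //; case: Bv.
  - rewrite size_map size_enum_ord => q0.
    rewrite (nth_map_enum_ord _ _ _ _ _ q0).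
    by case: Bv => _ _ _ [h _ _]; exact: h.
  - move=> g; rewrite size_map size_enum_ord => gq.
    have gq' : (g < q)%N by exact: ltnW.
    rewrite (nth_map_enum_ord _ _ _ _ _ gq) (nth_map_enum_ord _ _ _ _ _ gq').
    by case: Bv => _ _ _ [_ h _]; exact: h.
  - by rewrite big_map big_enum; case: Bv => _ _ _ [_ _ ->].
apply/ffunP => g; rewrite ffunE (nth_map_enum_ord _ _ _ _ _ (ltn_ord g)).
by congr (v _); apply: val_inj.
Qed.

Lemma atmost_card (T : choiceType) (N : nat) (A : set T) :
  atmost T N A -> finite_set A /\ (#|` fset_set A| <= N)%N.
Proof.
move=> [S sS AS].
have sub : (A `<=` [set` [fset x in S]%fset])%classic.
  by move=> x /AS xS /=; rewrite inE.
have finA : finite_set A by apply: sub_finite_set sub _; exact: finite_fset.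
split=> //; apply: leq_trans sS.
apply: (@leq_trans #|` [fset x in S]%fset|%N).
  apply: fsubset_leq_card; apply/fsubsetP => x.
  by rewrite in_fset_set // inE => /sub.
by rewrite card_fseq size_undup.
Qed.

(** * Explicit walks in [calB] with parameters b_r *)

Lemma digits_expand (p q M : nat) : (M < p ^ q)%N ->
  (\sum_(g < q) M %/ p ^ (q - g.+1) %% p * p ^ (q - g.+1))%N = M.
Proof.
elim: q M => [|q IH] M; first by rewrite big_ord0 expn0; case: M.
rewrite expnSr => Mlt.
have p0 : (0 < p)%N by case: p Mlt {IH} => //; rewrite muln0.
rewrite big_ord_recr /= subnn expn0 muln1 divn1 [RHS](divn_eq M p); congr (_ + _)%N.
rewrite -[in RHS](IH (M %/ p)%N); last by rewrite ltn_divLR.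
rewrite big_distrl; apply: eq_bigr => g _ /=.
rewrite subSn ?ltn_ord // expnS divnMA -mulnA; congr (_ * _)%N; exact: mulnC.
Qed.

Lemma digits_lt (p q : nat) (d : nat -> nat) : (forall g, g < q -> d g < p)%N ->
  (\sum_(g < q) d g * p ^ (q - g.+1) < p ^ q)%N.
Proof.
elim: q => [|q IH] dp; first by rewrite big_ord0 expn0.
rewrite big_ord_recr /= subnn expn0 muln1.
have -> : (\sum_(g < q) d g * p ^ (q.+1 - g.+1) =
           (\sum_(g < q) d g * p ^ (q - g.+1)) * p)%N.
  rewrite big_distrl; apply: eq_bigr => g _ /=.
  by rewrite -mulnA -expnSr subSn.
have := IH (fun g gq => dp g (ltnW gq)); have := dp q (ltnSn q).
rewrite expnS; set N := bigop _ _ _; nia.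
Qed.

(** For n - 2b >= 1 the letter comes from [PM] or [PMbar] with x + y = -2. The case n = b = 0 uses
    [Pc] and covers the leading zeros of nu and its first nonzero digit. *)
Lemma Upsilon1_grow (p : nat) (n n' b tau : int) : (2 <= p)%N ->
  0 <= tau < p%:Z -> n' = p%:Z * (n - 2 * b) + tau -> 0 <= b ->
  1 <= n - 2 * b \/ n = 0 /\ b = 0 ->
  Upsilon1 p (1, - n, - n', n' - n + 2 * b, n - b, b, tau + 1).
Proof.
move=> p2 tp -> b0 [h|[-> ->]]; left.
  exists 1, (- tau - p%:Z - 1), (tau - 1 + p%:Z), (n - b), b, (tau + 1).
  split.
    split; [lia|exact: b0|].
    have PMx : PM p 1 (- tau - p%:Z - 1) (tau - 1 + p%:Z) (tau + 1) by split; lia.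
    have [e|ne] := eqVneq (n - b) (b + 1); last by constructor 4; split=> //; lia.
    by constructor 3; split=> //; split=> // -[]; lia.
  rewrite /idx_j /idx_k; have -> : (b + 1 <= n - b) = true by lia.
  by congr (_, _, _, _, _, _, _); nia.
exists 1, (- tau), tau, 0, 0, (tau + 1); split.
  by split=> //; constructor 1; split=> //; split; [split|split]; lia.
by rewrite /idx_j /idx_k /= ; congr (_, _, _, _, _, _, _); lia.
Qed.

(** Leaving is free: a = b leads to 0 from an even state, a = b - 1 leads to 1 from an odd one. *)
Lemma Upsilon1_exit (p : nat) (h : int) (e : bool) : (2 <= p)%N -> 0 <= h ->
  Upsilon1 p (1, - (2 * h + e%:Z), e%:Z, 0, h, h + e%:Z, if e then p%:Z else 1).
Proof.
move=> p2 h0; left; case: e => /=.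
  exists 1, 0, 0, h, (h + 1), p%:Z; split.
    split; [lia|lia|constructor 2; split; first lia].
    by split; [split; lia|case; lia].
  rewrite /idx_j /idx_k; have -> : (h + 1 + 1 <= h) = false by lia.
  have -> : (h == h + 1) = false by lia.
  by congr (_, _, _, _, _, _, _); lia.
exists 1, 0, 0, h, h, 1; split.
  by split=> //; constructor 1; split=> //; split; [split|split]; lia.
rewrite /idx_j /idx_k eqxx; have -> : (h + 1 <= h) = false by lia.
by congr (_, _, _, _, _, _, _); lia.
Qed.

Lemma Upsilon1_rest (p : nat) (s : int) (e : bool) : 1 <= s <= p%:Z ->
  Upsilon1 p (s, e%:Z, e%:Z, 0, 0, 0, if e then p%:Z + 1 - s else s).
Proof.
case: e => hs; first by right; exists s.
left; exists s, 0, 0, 0, 0, s; split=> //.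
by split=> //; constructor 1; split=> //; split; [split|split]; lia.
Qed.

Section Path.
Variables (p R Q Z k m nu : nat) (b : nat -> nat).
Hypotheses (p_ge2 : (2 <= p)%N) (R_leQ : (R <= Q)%N) (Q_gt0 : (0 < Q)%N).
Hypothesis m_ltZ : (m.-1 < p ^ Z)%N.
Hypothesis nu_ltQ : (nu < p ^ Q)%N.
Hypothesis m_gt0 : (0 < m)%N.
Hypothesis b_eq0 : forall r, (R < r)%N -> b r = 0%N.
Hypothesis nuE : nu = (k + 2 * \sum_(1 <= r < Q.+1) b r * (p ^ r).-1)%N.
Hypothesis k_ge : (2 * (\sum_(1 <= r < Q.+1) b r) + p ^ R <= k)%N.

(* [- path_state r] is the index i of the r-th letter before the exit; the
   letter multiplies [path_state r - 2 * b r] by p and adds a digit of [nu]. *)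
Definition path_state (r : nat) : int :=
  (nu %/ p ^ r)%N%:Z - (2 * \sum_(r.+1 <= u < Q.+1) b u * p ^ (u - r))%N%:Z.

Let p_gt0 : (0 < p)%N. Proof. exact: ltnW. Qed.

Lemma path_stateS (r : nat) : (r < Q)%N ->
  path_state r = p%:Z * (path_state r.+1 - 2 * (b r.+1)%:Z) + (nu %/ p ^ r %% p)%N%:Z.
Proof.
move=> rQ; rewrite /path_state big_ltn // subSnn expn1.
have -> : (\sum_(r.+2 <= u < Q.+1) b u * p ^ (u - r) =
           (\sum_(r.+2 <= u < Q.+1) b u * p ^ (u - r.+1)) * p)%N.
  rewrite big_distrl big_nat [RHS]big_nat; apply: eq_bigr => u /andP[ru _] /=.
  by rewrite -mulnA -expnSr; congr (_ * p ^ _)%N; lia.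
rewrite {1}(divn_eq (nu %/ p ^ r) p) -divnMA -expnSr.
set N := bigop _ _ _; lia.
Qed.

Lemma path_stateQ : path_state Q = 0.
Proof. by rewrite /path_state big_geq // muln0 divn_small. Qed.

Lemma path_state0 : path_state 0 = k%:Z - (2 * \sum_(1 <= r < Q.+1) b r)%N%:Z.
Proof.
rewrite /path_state expn0 divn1.
have e : (\sum_(1 <= u < Q.+1) b u * p ^ (u - 0) =
    \sum_(1 <= u < Q.+1) b u * (p ^ u).-1 + \sum_(1 <= u < Q.+1) b u)%N.
  rewrite -big_split /=; apply: eq_bigr => u _.
  by rewrite subn0 -mulnSr prednK // expn_gt0 p_gt0.
rewrite e [in LHS]nuE; lia.
Qed.

(** Digits are at most p - 1 and b_r >= 0, so the recursion gives state(r) + 1 <= p (state(r + 1) +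
    1), which is iterated. *)
Lemma path_state0_le (r : nat) : (r <= Q)%N ->
  path_state 0 <= (p ^ r)%N%:Z * path_state r + (p ^ r)%N%:Z - 1.
Proof.
elim: r => [|r IH] rQ; first by rewrite expn0 mul1r addrK.
apply: le_trans (IH (ltnW rQ)) _.
rewrite (path_stateS r rQ) expnS.
have := ltn_pmod (nu %/ p ^ r) p_gt0.
have : (0 < p ^ r)%N by rewrite expn_gt0 p_gt0.
move: (path_state _) (p ^ r)%N (_ %% _)%N => n P t P0 tp.
have h : P%:Z * t%:Z <= P%:Z * (p%:Z - 1) by rewrite ler_wpM2l //; lia.
have h2 : 0 <= P%:Z * p%:Z * (b r.+1)%:Z by rewrite !mulr_ge0.
nia.
Qed.

(** This is the admissibility condition of [Upsilon1_grow]. For r < R the exit state is at least p^R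
    >= p^(r+1), and [path_state0_le] then makes n - 2b positive; beyond R all b vanish and the state
    is a leading part of [nu]. *)
Lemma path_state_gt (r : nat) : (r < Q)%N ->
  1 <= path_state r.+1 - 2 * (b r.+1)%:Z \/ path_state r.+1 = 0 /\ b r.+1 = 0%N.
Proof.
move=> rQ; have [rR|Rr] := ltnP r R; last first.
  have e : path_state r.+1 = (nu %/ p ^ r.+1)%N%:Z.
    rewrite /path_state big_nat big1 ?muln0 ?subr0 // => u hu.
    by rewrite b_eq0 //; lia.
  by rewrite e (b_eq0 r.+1) //; case: (nu %/ _)%N => [|x]; [right|left; lia].
left; have := path_state0_le r (ltnW rQ).
rewrite (path_stateS r rQ) path_state0.
have : (p ^ r.+1 <= p ^ R)%N by rewrite leq_pexp2l.
rewrite expnS.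
have := ltn_pmod (nu %/ p ^ r) p_gt0.
have : (0 < p ^ r)%N by rewrite expn_gt0 p_gt0.
move: k_ge; set S := bigop _ _ _; move: (p ^ R)%N => PR.
move: (path_state _) (p ^ r)%N (_ %% _)%N => n P t kge P0 tp PPR h.
have h' : P%:Z * t%:Z <= P%:Z * (p%:Z - 1) by rewrite ler_wpM2l //; lia.
have h2 : 0 < P%:Z * (p%:Z * (n - 2 * (b r.+1)%:Z)) by nia.
have : 0 < n - 2 * (b r.+1)%:Z; last lia.
by move: h2; rewrite !pmulr_rgt0 //; lia.
Qed.

(** One position is reserved for the exit letter, between Q digits of [nu] and Z digits of m - 1. *)
Let q := (Q + Z.+1)%N.
Let sd (g : nat) := (m.-1 %/ p ^ (q - g.+1) %% p)%N.

(** Past the negative states, t = s in state 0 and t = p + 1 - s in state 1, whence the complement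
    for odd [k]. *)
Definition path_digit (g : nat) : nat :=
  if (g < Q)%N then (nu %/ p ^ (Q - g.+1) %% p)%N
  else if odd k then (p.-1 - sd g)%N else sd g.

(** It depends on [nu] but not on [b]: all [b] with the same [nu] lead to the same l. *)
Definition path_end : nat := (\sum_(g < q) path_digit g * p ^ (q - g.+1)).+1.

(* At g = Q the walk leaves the negative states, for 0 or 1 according to the
   parity of k, and stays there while the digits of m - 1 are read. *)
Definition path_letter (g : nat) : vec7 :=
  if (g < Q)%N then
    let r := (Q - g)%N in
    (1, - path_state r, - path_state r.-1,
     path_state r.-1 - path_state r + 2 * (b r)%:Z,
     path_state r - (b r)%:Z, (b r)%:Z, (path_digit g)%:Z + 1)
  else let e : int := (odd k : nat)%:Z in
    let h : int := (k./2)%:Z - (\sum_(1 <= r < Q.+1) b r)%N%:Z in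
    if g == Q then (1, - (2 * h + e), e, 0, h, h + e, if odd k then p%:Z else 1)
    else ((sd g)%:Z + 1, e, e, 0, 0, 0,
          if odd k then p%:Z + 1 - ((sd g)%:Z + 1) else (sd g)%:Z + 1).

(** These positions have weight at least p^Z > m - 1; thus every letter up to the exit has s = 1. *)
Lemma sd_head (g : nat) : (g <= Q)%N -> sd g = 0%N.
Proof.
move=> gQ; rewrite /sd divn_small ?mod0n // (leq_trans m_ltZ) // leq_pexp2l //.
by rewrite /q; lia.
Qed.

Lemma sd_lt (g : nat) : (sd g < p)%N.
Proof using p_gt0. exact: ltn_pmod. Qed.

Lemma path_digit_lt (g : nat) : (path_digit g < p)%N.
Proof using p_gt0.
rewrite /path_digit; case: ifP => _; first exact: ltn_pmod.
by case: ifP => _; [rewrite (leq_ltn_trans (leq_subr _ _)) // prednK|exact: sd_lt].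
Qed.

Lemma path_letter_Upsilon1 (g : nat) : Upsilon1 p (path_letter g).
Proof.
rewrite /path_letter; case: ltnP => [gQ|Qg].
  have -> : (Q - g = (Q - g.+1).+1)%N by lia.
  have rQ : (Q - g.+1 < Q)%N by lia.
  apply: Upsilon1_grow => //.
  - by have := path_digit_lt g; lia.
  - by rewrite /= (path_stateS _ rQ) /path_digit gQ.
  - by have [?|[? ->]] := path_state_gt _ rQ; [left|right].
case: eqVneq => _; last by apply: Upsilon1_rest; have := sd_lt g; lia.
apply: Upsilon1_exit => //.
have := k_ge; have : (0 < p ^ R)%N by rewrite expn_gt0 p_gt0.
lia.
Qed.

Lemma path_letter_s (g : nat) : v_s (path_letter g) - 1 = (sd g)%:Z.
Proof.
rewrite /path_letter; case: ltnP => [gQ|Qg] /=.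
  by rewrite sd_head // ltnW.
case: eqVneq => [->|_] /=; first by rewrite sd_head.
by rewrite addrK.
Qed.

Lemma path_letter_t (g : nat) : v_t (path_letter g) - 1 = (path_digit g)%:Z.
Proof.
rewrite /path_letter; case: ltnP => [gQ|Qg] /=; first by rewrite addrK.
rewrite /path_digit ltnNge Qg /=; have := sd_lt g.
case: eqVneq => [->|_] /=; first by rewrite sd_head // subn0; case: odd; lia.
by case: odd; lia.
Qed.

Lemma path_state0_half : path_state 0 =
  2 * ((k./2)%:Z - (\sum_(1 <= r < Q.+1) b r)%N%:Z) + (odd k : nat)%:Z.
Proof. by rewrite path_state0 -{1}(odd_double_half k) -mul2n; lia. Qed.

Lemma path_letter_i (g : nat) : (g <= Q)%N ->
  v_i (path_letter g) = - path_state (Q - g).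
Proof.
rewrite /path_letter; case: ltnP => [gQ|Qg] //= gQ.
have -> : g = Q by lia.
by rewrite eqxx subnn path_state0_half.
Qed.

Lemma path_letter_ij (g : nat) : v_i (path_letter g.+1) = v_j (path_letter g).
Proof.
have [gQ|Qg] := ltnP g Q.
  by rewrite path_letter_i // /path_letter gQ /= -subnS.
rewrite /path_letter !ltnNge Qg (leqW Qg) /= gtn_eqF //=.
by case: eqP.
Qed.

Lemma sum_path_letter_k : \sum_(g < q) v_k (path_letter g) = k%:Z.
Proof.
(* The costs telescope to the current state plus twice the sum of the b_r used so far; at the exit
   this is k, and later letters are free. *)
have H j : (j <= Q)%N -> \sum_(g < j) v_k (path_letter g) =
    path_state (Q - j) + (2 * \sum_((Q - j).+1 <= r < Q.+1) b r)%N%:Z.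
  elim: j => [|j IH] jQ; first by rewrite big_ord0 subn0 path_stateQ big_geq.
  rewrite big_ord_recr /= (IH (ltnW jQ)) /path_letter jQ /= -subnS.
  rewrite [in RHS]big_ltn; last lia.
  have -> : ((Q - j.+1).+1 = Q - j)%N by lia.
  lia.
rewrite /q big_split_ord /= [X in _ + X]big1 => [|g _].
  by rewrite addr0 H // subnn path_state0 subrK.
by rewrite /path_letter ltnNge leq_addr /=; case: eqP.
Qed.

Lemma path_in_calB : calB p q k%:Z m path_end [ffun g : 'I_q => path_letter g].
Proof.
split.
- by move=> g; rewrite ffunE; exact: path_letter_Upsilon1.
- have m_lt : (m.-1 < p ^ q)%N.
    by apply: leq_trans m_ltZ _; rewrite leq_pexp2l // /q; lia.
  transitivity (m.-1%:Z); first by lia.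
  rewrite -[in LHS](digits_expand p q m.-1 m_lt) (big_morph _ PoszD (erefl 0%:Z)).
  by apply: eq_bigr => g _; rewrite ffunE path_letter_s PoszM.
- rewrite /path_end -addn1 PoszD addrK (big_morph _ PoszD (erefl 0%:Z)).
  by apply: eq_bigr => g _; rewrite ffunE path_letter_t PoszM.
- split.
  + move=> g g0; rewrite ffunE path_letter_i g0 //.
    by rewrite subn0 path_stateQ oppr0.
  + by move=> g h hg; rewrite !ffunE hg path_letter_ij.
  + by under eq_bigr do rewrite ffunE; exact: sum_path_letter_k.
Qed.

(** Recovers [b] from the tuple, for injectivity in the count. *)
Lemma path_letter_b (r : nat) : (r < Q)%N ->
  v_b (path_letter (Q - r.+1)) = (b r.+1)%:Z.
Proof using Type.
by move=> rQ; rewrite /path_letter ltn_subrL /= (leq_ltn_trans (leq0n r) rQ) subKn.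
Qed.

Lemma path_end_range : (1 <= path_end <= p ^ q)%N.
Proof using p_gt0.
by apply: digits_lt => g _; exact: path_digit_lt.
Qed.
End Path.

(** * Counting the walks by the pigeonhole principle *)

Lemma popular_value (T : finType) (V : nat) (W : T -> nat) : (0 < V)%N ->
  (forall x, W x < V)%N ->
  exists w : nat, (#|T| <= #|[set x | W x == w]| * V)%N.
Proof.
move=> V0 WV; apply: contrapT => nW.
have lt w : (#|[set x | W x == w]| * V < #|T|)%N.
  by rewrite ltnNge; apply/negP => ?; apply: nW; exists w.
have T0 : (0 < #|T|)%N by apply: leq_ltn_trans (lt 0%N).
have e : #|T| = (\sum_(w < V) #|[set x | W x == w]|)%N.
  rewrite -cardsT -sum1_card (partition_big (fun x => Ordinal (WV x)) xpredT) //=.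
  apply: eq_bigr => w _; rewrite -sum1_card; apply: eq_bigl => x.
  by rewrite !inE.
have : (\sum_(w < V) #|[set x | W x == w]| * V <= \sum_(w < V) #|T|.-1)%N.
  by apply: leq_sum => w _; have := lt w; lia.
rewrite -big_distrl -e sum_nat_const card_ord /= => h.
have : (#|T| * V <= V * #|T|.-1)%N by [].
by nia.
Qed.

Lemma leq_card_fset_set (T : finType) (U : choiceType) (S : {set T}) (A : set U)
    (f : T -> U) : finite_set A -> (forall x, x \in S -> A (f x)) ->
  {in S &, injective f} -> (#|S| <= #|` fset_set A|)%N.
Proof.
move=> finA SA finj; rewrite cardE -(size_map f).
apply: uniq_leq_size.
  by rewrite map_inj_in_uniq ?enum_uniq // => x y; rewrite !mem_enum; exact: finj.
move=> u /mapP[x]; rewrite mem_enum => xS ->.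
by rewrite in_fset_set // inE; exact: SA.
Qed.

Lemma card_calB_lower (p R B k m : nat) : (2 <= p)%N -> (0 < m)%N ->
  (2 * (R * B) + p ^ R <= k)%N ->
  exists q l : nat, [/\ (2 <= q)%N, (1 <= m <= p ^ q)%N, (1 <= l <= p ^ q)%N &
    (B.+1 ^ R <= #|` fset_set (calB p q k%:Z m l)| * (B.+1 * p ^ R.+1))%N].
Proof.
move=> p2 m0 hk; have p0 : (0 < p)%N by exact: ltnW.
pose T : finType := {ffun 'I_R -> 'I_B.+1}.
(* Extension of [f] by 0 beyond R; the b_r are numbered from 1, whence [r.-1]. *)
pose bb (f : T) (r : nat) : nat := if insub r.-1 is Some i then f i : nat else 0%N.
pose W (f : T) := (\sum_(1 <= r < R.+1) bb f r * (p ^ r).-1)%N.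
have bbE (f : T) (i : 'I_R) : bb f i.+1 = f i by rewrite /bb /= valK.
have bb_le (f : T) r : (bb f r <= B)%N.
  by rewrite /bb; case: insub => // i; rewrite -ltnS.
have bb0 (f : T) r : (R < r)%N -> bb f r = 0%N.
  by move=> Rr; rewrite /bb insubF //; lia.
have sum_pow n : (\sum_(1 <= r < n.+1) p ^ r <= p ^ n.+1)%N.
  elim: n => [|n IH]; first by rewrite big_geq.
  rewrite big_nat_recr //= [in leqRHS]expnS.
  by have := IH; move: (p ^ n.+1)%N => P; nia.
have WV (f : T) : (W f < B.+1 * p ^ R.+1)%N.
  apply: (@leq_ltn_trans (\sum_(1 <= r < R.+1) B * p ^ r)%N).
    by apply: leq_sum => r _; rewrite leq_mul ?leq_pred.
  rewrite -big_distrr /=; apply: (@leq_ltn_trans (B * p ^ R.+1)%N).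
    by rewrite leq_mul2l sum_pow orbT.
  by rewrite ltn_mul2r ltnSn expn_gt0 p0.
have V0 : (0 < B.+1 * p ^ R.+1)%N by rewrite muln_gt0 expn_gt0 p0.
have [w hw] := popular_value T _ W V0 WV.
(* A crude number of digits: Q exceeds both R and [nu], so nu < p^Q. Likewise Z = m works, as m - 1
   < p^m. *)
pose nu := (k + 2 * w)%N; pose Q := (R + nu).+1.
have RQ : (R <= Q)%N by rewrite /Q; lia.
have ext (f : T) (F : nat -> nat) :
    (\sum_(1 <= r < Q.+1) bb f r * F r = \sum_(1 <= r < R.+1) bb f r * F r)%N.
  rewrite (@big_cat_nat _ _ _ R.+1) //= [X in (_ + X)%N]big_nat.
  by rewrite [X in (_ + X)%N]big1 ?addn0 // => r /andP[Rr _]; rewrite bb0.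
have sum_bb (f : T) : (\sum_(1 <= r < Q.+1) bb f r <= R * B)%N.
  have := ext f (fun=> 1%N); under eq_bigr do rewrite muln1.
  under [in RHS]eq_bigr do rewrite muln1.
  move=> ->; rewrite -[leqRHS](_ : (\sum_(1 <= r < R.+1) B)%N = _).
    exact: leq_sum.
  by rewrite sum_nat_const_nat subn1.
have m_lt : (m.-1 < p ^ m)%N.
  by rewrite (leq_ltn_trans (leq_pred _)) // ltn_expl.
have nu_lt : (nu < p ^ Q)%N.
  by apply: leq_trans (ltn_expl nu p2) _; rewrite leq_pexp2l // /Q; lia.
have nuE (f : T) : f \in [set x | W x == w] ->
    nu = (k + 2 * \sum_(1 <= r < Q.+1) bb f r * (p ^ r).-1)%N.
  by rewrite inE => /eqP fw; rewrite ext -/(W f) fw.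
have k_ge (f : T) : (2 * (\sum_(1 <= r < Q.+1) bb f r) + p ^ R <= k)%N.
  by apply: leq_trans hk; rewrite leq_add2r leq_mul2l sum_bb orbT.
set q := (Q + m.+1)%N.
exists q, (path_end p Q m k m nu).
have l_range := path_end_range p Q m k m nu p2.
split=> //; first by rewrite /q /Q; lia.
  rewrite m0 (leq_trans (ltnW (ltn_expl m p2))) // leq_pexp2l // /q; lia.
have card_T : #|T| = (B.+1 ^ R)%N by rewrite card_ffun !card_ord.
rewrite -card_T (leq_trans hw) // leq_mul2r; apply/orP; right.
have [finB _] := atmost_card _ _ _
  (calB_atmost p q k m (path_end p Q m k m nu) p2 m0 (proj1 (andP l_range))).
apply: (leq_card_fset_set _ _ _ _
  (fun f : T => [ffun g : 'I_q => path_letter p Q m k m nu (bb f) g])) => //.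
  move=> f fw.
  exact: (path_in_calB p R Q m k m nu (bb f) p2 RQ isT m_lt nu_lt m0 (bb0 f) (nuE f fw) (k_ge f)).
(* The letter at position Q - (i + 1) carries [f i] as its component b. *)
move=> f f' _ _ e; apply/ffunP => i; apply: val_inj.
have iq : (Q - i.+1 < q)%N by rewrite /q /Q; lia.
have := congr1 (fun u : {ffun 'I_q -> vec7} => v_b (u (Ordinal iq))) e.
rewrite !ffunE /=.
have iQ : (i < Q)%N by apply: leq_trans RQ.
rewrite !path_letter_b // !bbE.
by case.
Qed.

(** * Bounds for Gamma and for the constant *)

(* The real-valued integral is 0 where the integral is infinite, and then the
   division by Gamma gives 0, so convergence need not be established. *)
Lemma Gamma_dichotomy (R : realType) (z : R) : 1 <= z ->
  Gamma z = 0 \/ expR (- 2) <= Gamma z.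
Proof.
move=> z1; rewrite /Gamma /Rintegral.
pose g := fun u : R => u `^ (z - 1) * expR (- u).
pose f := EFin \o g.
set I := (\int[_]_(_ in _) _)%E.
have mf (D : set R) : measurable D -> measurable_fun D f.
  move=> mD; apply/measurable_EFinP; rewrite /g; apply: measurable_funM.
    by apply: measurable_funTS; exact: measurable_powR.
  by apply: measurable_funTS; apply: measurableT_comp => //; exact: measurable_expR.
have f0 (u : R) : (0 <= f u)%E by rewrite lee_fin /g mulr_ge0 ?powR_ge0 ?expR_ge0.
(* On [1, 2] the integrand is at least e^(-2), and the interval has length 1. *)
pose D12 : set R := `[1%R, 2%R]%classic.
have mD12 : lebesgue_measure D12 = 1%:E.
  rewrite /D12 lebesgue_measure_itv /= lte_fin ltr1n /= -EFinD.
  by congr EFin; lra.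
have D12m : measurable D12 by rewrite /D12; exact: measurable_itv.
have le12 : ((expR (- 2))%:E <= \int[lebesgue_measure]_(u in D12) f u)%E.
  have -> : (expR (- 2))%:E =
      (\int[lebesgue_measure]_(u in D12) cst (expR (- 2 : R))%:E u)%E.
    by rewrite (integral_cst lebesgue_measure D12m) [X in (_ * X)%E]mD12 mule1.
  apply: ge0_le_integral => //.
  - by move=> u _; rewrite lee_fin expR_ge0.
  - by apply: mf.
  - rewrite /D12 => u /=; rewrite in_itv /= => /andP[u1 u2]; rewrite lee_fin.
    rewrite /g -[leLHS]mul1r ler_pM ?expR_ge0 ?ler_expR ?lerN2 //.
    by rewrite -[leLHS](powRr0 u) ler_powR // subr_ge0.
have leI : (\int[lebesgue_measure]_(u in D12) f u <= I)%E.
  apply: ge0_subset_integral => //; first by apply: mf.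
  by rewrite /D12 => u /=; rewrite !in_itv /= => /andP[u1 _]; rewrite andbT; lra.
have := le_trans le12 leI.
by case: I {leI} => [r| |]; [rewrite lee_fin; right|left|].
Qed.

(** The factors lie in [0, 1], so the partial products decrease from the empty product 1. *)
Lemma C1_le_half (R : realType) (p : nat) : 0 <= C1 R p <= 2^-1.
Proof.
rewrite /C1; set u := fun n : nat => \prod_(_ <= _ < _) _.
have term_ge0 j : 0 <= 1 - ((p.+1)%:R ^+ j + 1 : R)^-1 <= 1.
  have h : 0 <= ((p.+1)%:R : R) ^+ j by exact: exprn_ge0.
  have h1 : 0 < ((p.+1)%:R : R) ^+ j + 1 by lra.
  have h2 : 1 <= ((p.+1)%:R : R) ^+ j + 1 by lra.
  by rewrite subr_ge0 (invf_le1 h1) h2 gerBl invr_ge0 ltW.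
have u_ge0 n : 0 <= u n by apply: prodr_ge0 => j _; case/andP: (term_ge0 j).
have u_noninc : nonincreasing_seq u.
  apply/nonincreasing_seqP => n; rewrite /u [leLHS]big_nat_recr //=; apply: ler_piMr.
    exact: u_ge0.
  by case/andP: (term_ge0 n.+1).
have u_cvg : cvgn u.
  by apply: nonincreasing_is_cvgn => //; exists 0 => _ [n _ <-].
have lim_ge0 : 0 <= limn u by apply: limr_ge => //; near=> n; exact: u_ge0.
have : limn u <= u 0%N by exact: nonincreasing_cvgn_ge.
rewrite {2}/u big_geq // => lim_le1.
by apply/andP; split; lra.
Unshelve. all: by end_near.
Qed.

(** * Comparison of the count with the claimed bound *)

Lemma sqr16_leq_exp3 (r : nat) : (5 <= r)%N -> (16 * r ^ 2 <= 3 ^ r.+1)%N.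
Proof.
elim: r => // r IH r4; have [r5|r5] := leqP 5 r; last by have -> : r = 4%N by lia.
by have := IH r5; rewrite [(3 ^ r.+2)%N]expnS; move: (3 ^ r.+1)%N => P; nia.
Qed.

(** Squaring keeps the half-integral exponent within the naturals; the 9 is tailored to
    [growth_le]. *)
Lemma card_calB_sqr_lower (p k m : nat) : (2 <= p)%N -> (0 < k)%N -> (0 < m)%N ->
  exists q l : nat, [/\ (2 <= q)%N, (1 <= m <= p ^ q)%N, (1 <= l <= p ^ q)%N &
    (k ^ (trunc_log p.+1 k - 9) <= #|` fset_set (calB p q k%:Z m l)| ^ 2)%N].
Proof.
move=> p2 k0 m0; set T := trunc_log p.+1 k.
(* For T <= 9 the power is 1 and a single walk, with R = B = 0, suffices. *)
have [T9|T9] := leqP T 9.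
  have [|q [l [q2 mq lq h]]] := card_calB_lower p 0 0 k m p2 m0.
    by rewrite mul0n muln0 expn0.
  exists q, l; split=> //.
  have -> : (T - 9 = 0)%N by lia.
  by rewrite expn0 expn_gt0; move: h; rewrite expn0 mul1n; nia.
have Tk : (p.+1 ^ T <= k)%N by apply: trunc_logP => //; lia.
have T3 : (3 ^ T <= k)%N by apply: leq_trans Tk; rewrite leq_exp2r //; lia.
have Tp : (p ^ T <= k)%N by apply: leq_trans Tk; rewrite leq_exp2r //; lia.
case: T T9 Tk T3 Tp => // r r9 _ r3 rp.
(* With R = r, both 2RB and p^R are at most k/2; and 4r(B + 1) > k with (4r)^2 <= k gives (B + 1)^2
   >= k. *)
pose B := (k %/ (4 * r))%N.
have kB : (k < B.+1 * (4 * r))%N by apply: ltn_ceil; lia.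
have Bk : (B * (4 * r) <= k)%N by apply: leq_trunc_div.
have [|q [l [q2 mq lq h]]] := card_calB_lower p r B k m p2 m0.
  by move: rp; rewrite expnS; move: (p ^ r)%N => P; nia.
exists q, l; split=> //; set N := #|` _| in h *.
have sqB : (k <= B.+1 ^ 2)%N.
  have := sqr16_leq_exp3 r (ltnW (ltnW (ltnW (ltnW r9)))) => r16.
  rewrite -(leq_pmul2l k0); apply: (@leq_trans (B.+1 ^ 2 * (16 * r ^ 2))%N).
    by rewrite (_ : B.+1 ^ 2 * (16 * r ^ 2) = (B.+1 * (4 * r)) * (B.+1 * (4 * r)))%N;
      [rewrite leq_mul // ltnW|lia].
  by rewrite mulnC leq_mul2r (leq_trans r16 r3) orbT.
have [s rs] : exists s, r = s.+1 by exists r.-1; lia.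
have hN : (B.+1 ^ s <= N * k)%N.
  rewrite -(leq_pmul2l (ltn0Sn B)) -expnS -rs (leq_trans h) //.
  by rewrite mulnCA leq_mul2l leq_mul2l rp !orbT.
have : (k ^ s <= (N * k) ^ 2)%N.
  apply: (@leq_trans ((B.+1 ^ 2) ^ s)%N); first by rewrite leq_exp2r //; lia.
  by rewrite -expnM mulnC expnM leq_exp2r.
(* Dividing by k^2 leaves the exponent s - 2 = T - 4 >= T - 9, where T is now r + 1. *)
rewrite expnMn => hs.
rewrite -(@leq_pmul2r (k ^ 2)) ?expn_gt0 ?k0 // (leq_trans _ hs) //.
by rewrite -expnD leq_pexp2l //; lia.
Qed.

Lemma nat_set_max (A : set nat) (M n0 : nat) : A n0 ->
  (forall n, A n -> (n <= M)%N) ->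
  exists X, A X /\ forall n, A n -> (n <= X)%N.
Proof.
move=> An0 AM.
have ex : exists n, `[< A n >] by exists n0; apply/asboolP.
have ub n : `[< A n >] -> (n <= M)%N by move=> /asboolP; exact: AM.
have [X /asboolP AX Xmax] := ex_maxnP ex ub.
by exists X; split=> // n An; apply: Xmax; apply/asboolP.
Qed.

(** Convexity gives e^(-1/2) >= 1 - 1/2; take fourth powers. *)
Lemma expRN2_ge (R : realType) : 16^-1 <= expR (- 2 : R).
Proof.
have h : 2^-1 <= expR (- 2^-1 : R) by have := expR_ge1Dx (- 2^-1 : R); lra.
rewrite (_ : - 2 = 4%:R * - 2^-1 :> R); last by field.
rewrite expRM_natl (_ : 16^-1 = 2^-1 ^+ 4 :> R); last by field.
by rewrite lerXn2r ?nnegrE ?expR_ge0 //; lra.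
Qed.

Lemma growth_le (R : realType) (p k N : nat) : (2 <= p)%N -> (10 <= k)%N ->
  (k ^ (trunc_log p.+1 k - 9) <= N ^ 2)%N ->
  C1 R p * (k%:R `^ (logb (p.+1)%:R k%:R / 2 - 6) / Gamma (logb (p.+1)%:R k%:R + 1))
    <= (N%:R : R).
Proof.
move=> p2 k10 hN; set L := logb _ _; set T := trunc_log _ _ in hN.
have k1 : 1 <= (k%:R : R) by rewrite ler1n; lia.
have lnp : 0 < ln ((p.+1)%:R : R) by rewrite ln_gt0 // ltr1n; lia.
have L0 : 0 <= L.
  rewrite /L /logb divr_ge0 //; last exact: ltW.
  exact: ln_ge0.
have LT : L < T%:R + 1.
  rewrite /L /logb ltr_pdivrMr // natr1 mulr_natl -lnXn ?ltr0n //.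
  rewrite ltr_ln ?posrE ?exprn_gt0 ?ltr0n //; last lia.
  by rewrite -natrX ltr_nat trunc_log_ltn //; lia.
set y := k%:R `^ _.
have y0 : 0 <= y by exact: powR_ge0.
(* L < T + 1 gives (y k)^2 = k^(L - 10) <= k^(T - 9); for T < 9 the truncated exponent is only
   larger. *)
have ky : (y * k%:R) ^+ 2 <= (N%:R : R) ^+ 2.
  have kn0 : k%:R != 0 :> R by rewrite pnatr_eq0; lia.
  have -> : y * k%:R = k%:R `^ (L / 2 - 5).
    rewrite -[X in y * X](powRr1 (le_trans ler01 k1)) -powRD ?kn0 ?implybT //.
    by congr (_ `^ _); ring.
  rewrite expr2 -powRD ?kn0 ?implybT //.
  apply: (@le_trans _ _ (k%:R `^ (T - 9)%N%:R)).
    apply: ler_powR => //.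
    have : (T%:R : R) <= (T - 9)%N%:R + 9 by rewrite -natrD ler_nat; lia.
    lra.
  by rewrite powR_mulrn ?(le_trans ler01) // -!natrX ler_nat.
have yN : y * k%:R <= N%:R.
  by rewrite -(ler_pXn2r (ltn0Sn 1)) ?nnegrE ?mulr_ge0.
(* The spare factor k >= 10 absorbs the constants, since C1 <= 1/2 and 1 / Gamma <= 16 give at most
   8. *)
have y10 : 10 * y <= N%:R.
  apply: le_trans yN; rewrite mulrC ler_wpM2l //.
  by rewrite ler_nat.
have /andP[C0 C12] := C1_le_half R p.
have [->|G] : Gamma (L + 1) = 0 \/ expR (- 2) <= Gamma (L + 1).
  by apply: Gamma_dichotomy; lra.
  by rewrite invr0 !mulr0.
have G16 : 16^-1 <= Gamma (L + 1) := le_trans (expRN2_ge R) G.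
have Gpos : 0 < Gamma (L + 1) by lra.
have yG : y / Gamma (L + 1) <= 16 * y.
  rewrite ler_pdivrMr //.
  have : 0 <= y * (16 * Gamma (L + 1) - 1) by rewrite mulr_ge0 //; lra.
  lra.
apply: (@le_trans _ _ (2^-1 * (16 * y))); last lra.
by rewrite ler_pM ?divr_ge0 // ltW.
Qed.

Theorem theorem46 (R : realType) (p : nat) (F : closedFieldType)
    (p_prime : prime p) (char_F : p \in [pchar F])
    (blk : nat -> seq (nat * nat))
    (blk_block : forall q : nat, (2 <= q)%N ->
       block_weights F (blk q) /\ size (blk q) = (p ^ q)%N)
    (* the Miemietz--Turner description of the Ext groups *)
    (Miemietz_Turner : forall q k m l : nat, (2 <= q)%N ->
       (1 <= m <= p ^ q)%N -> (1 <= l <= p ^ q)%N ->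
       dim_ext k (Delta F (blk q) m) (Delta F (blk q) l) =
       #|` fset_set (calB p q k%:Z m l)|)
    (k m : nat) (k_ge10 : (10 <= k)%N) (m_ge1 : (1 <= m)%N) :
  exists X : nat, is_max_ext_dim F p blk m k X /\
    C1 R p *
      (k%:R `^ (logb (p.+1)%:R k%:R / 2 - 6) / Gamma (logb (p.+1)%:R k%:R + 1))
    <= (X%:R : R).
Proof.
have p2 : (2 <= p)%N := prime_gt1 p_prime.
have k_gt0 : (0 < k)%N by exact: leq_trans k_ge10.
have [q [l [q2 mq lq hN]]] := card_calB_sqr_lower p k m p2 k_gt0 m_ge1.
have N_in : ext_dims F p blk m k #|` fset_set (calB p q k%:Z m l)|.
  by exists q, l; split=> //; rewrite Miemietz_Turner.
have ub n : ext_dims F p blk m k n -> (n <= (k.+2 ^ 4) ^ (2 * (k + m)).+1)%N.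
  move=> [q' [l' [q'2 mq' lq' ->]]]; rewrite Miemietz_Turner //.
  have /andP[l1 _] := lq'.
  by have [_] := atmost_card _ _ _ (calB_atmost p q' k m l' p2 m_ge1 l1).
have [X [X_in Xmax]] := nat_set_max _ _ _ N_in ub.
exists X; split=> //; apply: le_trans (growth_le R p k _ p2 k_ge10 hN) _.
by rewrite ler_nat; exact: Xmax.
Qed.
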